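(* Let $\{A,B,C\}$ be a set of three distinct points, all in $H^2$ or all in $-H^2$ (a hyperbolic or antipodal hyperbolic triangle), with side lengths $a,b,c$ opposite $A,B,C$ and angles $\alpha,\beta,\gamma$ at $A,B,C$, respectively. Then $$\frac{\sin(\alpha)}{\sinh(a)}=\frac{\sin(\beta)}{\sinh(b)}=\frac{\sin(\gamma)}{\sinh(c)}.$$
   Context: On $\mathbb{R}^3$ let $\langle\langle x,y\rangle\rangle=-x_1y_1+x_2y_2+x_3y_3$, $|||x|||=\sqrt{|\langle\langle x,x\rangle\rangle|}$, and let $\times$ be the usual Euclidean cross product. $H^2=\{x:\langle\langle x,x\rangle\rangle=-1,\ x_1>0\}$ and $-H^2=\{-x:x\in H^2\}$. For $x,y$ both in $H^2$ or both in $-H^2$ the distance is $d(x,y)=\operatorname{arcosh}(-\langle\langle x,y\rangle\rangle)$. Side lengths: $a=d(B,C)$, $b=d(A,C)$, $c=d(A,B)$. For distinct $A,B$ both in $H^2$ or both in $-H^2$, the unit tangent vector at $A$ towards $B$ is $X_{AB}=\dfrac{B+\langle\langle A,B\rangle\rangle A}{|||A\times B|||}$. The angle at $A$ is $\alpha=\arccos(\langle\langle X_{AB},X_{AC}\rangle\rangle)$; $\beta$ (at $B$) and $\gamma$ (at $C$) are defined analogously. *)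

(* Defs.v *)
From mathcomp Require Import all_boot all_order all_algebra.
From mathcomp Require Import ring lra.
From mathcomp Require Import classical_sets reals sequences exp trigo.

Set Implicit Arguments.
Unset Strict Implicit.
Unset Printing Implicit Defensive.
Import Order.TTheory GRing.Theory Num.Theory.
Local Open Scope classical_set_scope.
Local Open Scope ring_scope.

Section HyperbolicFunctions.
Context {R : realType}.
Implicit Type x : R.

Definition sinh x : R := (expR x - expR (- x)) / 2.

Definition cosh x : R := (expR x + expR (- x)) / 2.

(* The inverse of cosh on [0, +oo[, meaningful for 1 <= x: see arcosh_ge0,
   arcoshK and coshK below. *)
Definition arcosh x : R := ln (x + Num.sqrt (x ^+ 2 - 1)).

Lemma arcosh_ge0 x : 1 <= x -> 0 <= arcosh x.
Proof.
by move=> x1; apply: ln_ge0; rewrite -[1]addr0 lerD// sqrtr_ge0.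
Qed.

Lemma arcoshK x : 1 <= x -> cosh (arcosh x) = x.
Proof.
move=> x1; rewrite /cosh /arcosh.
have s0 : 0 <= Num.sqrt (x ^+ 2 - 1) by exact: sqrtr_ge0.
have sE : Num.sqrt (x ^+ 2 - 1) ^+ 2 = x ^+ 2 - 1.
  by rewrite sqr_sqrtr//; nra.
have t0 : 0 < x + Num.sqrt (x ^+ 2 - 1) by lra.
rewrite expRN lnK ?posrE//.
have -> : (x + Num.sqrt (x ^+ 2 - 1))^-1 = x - Num.sqrt (x ^+ 2 - 1).
  apply: (mulfI (lt0r_neq0 t0)); rewrite mulfV ?lt0r_neq0//.
  by rewrite [RHS]mulrC -subr_sqr sE; ring.
by field.
Qed.

Lemma coshK x : 0 <= x -> arcosh (cosh x) = x.
Proof.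
move=> x0; rewrite /arcosh.
have e1 : expR (- x) <= expR x by rewrite ler_expR; lra.
have e2 : expR x * expR (- x) = 1 by rewrite -expRD subrr expR0.
have -> : cosh x ^+ 2 - 1 = sinh x ^+ 2.
  by rewrite /cosh /sinh -[X in _ - X]e2; field.
rewrite sqrtr_sqr ger0_norm; last by rewrite /sinh; lra.
have -> : cosh x + sinh x = expR x by rewrite /cosh /sinh; field.
by rewrite expRK.
Qed.

End HyperbolicFunctions.

Section MinkowskiSpace.
Context {R : realType}.
Implicit Types u v A B C : 'rV[R]_3.

(* The columns 0, 1, 2 of a row vector are the coordinates x_1, x_2, x_3. *)
Definition minkowski u v : R :=
  - (u 0 0 * v 0 0) + u 0 1 * v 0 1 + u 0 2 * v 0 2.

Definition mnorm u : R := Num.sqrt `|minkowski u u|.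

Definition crossp u v : 'rV[R]_3 :=
  \row_(i < 3) [:: u 0 1 * v 0 2 - u 0 2 * v 0 1;
                   u 0 2 * v 0 0 - u 0 0 * v 0 2;
                   u 0 0 * v 0 1 - u 0 1 * v 0 0]`_i.

Definition H2 : set 'rV[R]_3 := [set u | minkowski u u = -1 /\ 0 < u 0 0].

Definition oppH2 : set 'rV[R]_3 := [set - u | u in H2].

Definition hdist A B : R := arcosh (- minkowski A B).

(* The unit tangent vector at A towards B. *)
Definition tangent A B : 'rV[R]_3 :=
  (mnorm (crossp A B))^-1 *: (B + minkowski A B *: A).

(* The angle at A between the directions of B and C. *)
Definition hangle A B C : R := acos (minkowski (tangent A B) (tangent A C)).

End MinkowskiSpace.

(* Main.v *)
Require Import Defs.
From mathcomp Require Import all_boot all_order all_algebra.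
From mathcomp Require Import ring lra.
From mathcomp Require Import classical_sets reals sequences exp trigo.

Set Implicit Arguments.
Unset Strict Implicit.
Unset Printing Implicit Defensive.

Import Order.TTheory GRing.Theory Num.Theory.
Local Open Scope classical_set_scope.
Local Open Scope ring_scope.

(** With p = cosh c, q = cosh b and r = cosh a, the tangent vectors at A give
    the law of cosines cos alpha = (p q - r) / (sinh c sinh b). Hence
    sin alpha / sinh a = sqrt D / (sinh a sinh b sinh c), where
    D = (p^2 - 1)(q^2 - 1) - (p q - r)^2 = 1 + 2 p q r - p^2 - q^2 - r^2 is
    symmetric in the three points: up to sign it is the Gram determinant of
    A, B, C, i.e. D = det(A, B, C)^2, which is also why D >= 0. *)

Lemma sinh_ge0 {R : realType} (x : R) : 0 <= x -> 0 <= sinh x.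
Proof.
move=> x0; rewrite /sinh divr_ge0// subr_ge0 ler_expR.
by rewrite (le_trans _ x0)// oppr_le0.
Qed.

Lemma cosh2_sinh2 {R : realType} (x : R) : cosh x ^+ 2 - sinh x ^+ 2 = 1.
Proof.
have <- : expR x * expR (- x) = 1 by rewrite -expRD subrr expR0.
by rewrite /cosh /sinh; field.
Qed.

Lemma sinh_arcosh {R : realType} (x : R) :
  1 <= x -> sinh (arcosh x) = Num.sqrt (x ^+ 2 - 1).
Proof.
move=> x1; have := cosh2_sinh2 (arcosh x); rewrite arcoshK// => E.
have -> : x ^+ 2 - 1 = sinh (arcosh x) ^+ 2 by rewrite -E; ring.
by rewrite sqrtr_sqr ger0_norm// sinh_ge0// arcosh_ge0.
Qed.

Section Minkowski.
Context {R : realType}.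
Implicit Types u v A B C : 'rV[R]_3.

Lemma minkowskiC u v : minkowski u v = minkowski v u.
Proof. by rewrite /minkowski; ring. Qed.

Lemma row3P u v :
  u 0 0 = v 0 0 -> u 0 1 = v 0 1 -> u 0 2 = v 0 2 -> u = v.
Proof.
move=> e0 e1 e2; apply/rowP => -[[|[|[|//]]] lti].
- by rewrite (_ : Ordinal lti = 0)//; apply/val_inj.
- by rewrite (_ : Ordinal lti = 1)//; apply/val_inj.
- by rewrite (_ : Ordinal lti = 2)//; apply/val_inj.
Qed.

(* Lagrange's identity: the sign is opposite to the Euclidean one. *)
Lemma minkowski_crossp u v :
  minkowski (crossp u v) (crossp u v) =
  minkowski u v ^+ 2 - minkowski u u * minkowski v v.
Proof. by rewrite /minkowski /crossp !mxE /=; ring. Qed.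

(* Reverse Cauchy-Schwarz: writing u = (u_1, x) and v = (v_1, y),
   (u_1 v_1)^2 = (1 + x.y)^2 + |x - y|^2 + (x_1 y_2 - x_2 y_1)^2. *)
Lemma minkowski_lt_N1 u v :
  minkowski u u = -1 -> minkowski v v = -1 -> 0 < u 0 0 * v 0 0 -> u <> v ->
  1 < - minkowski u v.
Proof.
rewrite /minkowski => Hu Hv uv0 neq_uv.
rewrite ltNge; apply/negP => le1; apply: neq_uv.
move: (@row3P u v) Hu Hv uv0 le1.
move: (u 0 0) (u 0 1) (u 0 2) (v 0 0) (v 0 1) (v 0 2).
move=> u0 u1 u2 v0 v1 v2 ext Hu Hv uv0 le1.
have E : (u0 * v0) ^+ 2 = (1 + (u1 * v1 + u2 * v2)) ^+ 2
    + ((u1 - v1) ^+ 2 + (u2 - v2) ^+ 2 + (u1 * v2 - u2 * v1) ^+ 2).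
  have -> : (u0 * v0) ^+ 2 = (u0 * u0) * (v0 * v0) by ring.
  have -> : u0 * u0 = 1 + u1 * u1 + u2 * u2 by lra.
  have -> : v0 * v0 = 1 + v1 * v1 + v2 * v2 by lra.
  by ring.
(* The negated claim reads [u0 * v0 <= 1 + (u1 * v1 + u2 * v2)] with a positive left side, so it may
   be squared. Against [E] this forces all three squares to vanish. *)
have le2 : (u0 * v0) ^+ 2 <= (1 + (u1 * v1 + u2 * v2)) ^+ 2.
  by rewrite ler_pXn2r ?nnegrE //; lra.
have s1 := sqr_ge0 (u1 - v1); have s2 := sqr_ge0 (u2 - v2).
have s3 := sqr_ge0 (u1 * v2 - u2 * v1).
have /eqP : (u1 - v1) ^+ 2 = 0 by lra.
rewrite sqrf_eq0 subr_eq0 => /eqP e1.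
have /eqP : (u2 - v2) ^+ 2 = 0 by lra.
rewrite sqrf_eq0 subr_eq0 => /eqP e2.
apply: ext => //; subst v1 v2.
(* With equal spatial parts, the first coordinates agree up to sign; [uv0] excludes opposite
   signs. *)
have /eqP : u0 ^+ 2 = v0 ^+ 2 by rewrite !expr2; lra.
by rewrite eqf_sqr => /orP[/eqP//|/eqP e0]; exfalso; nra.
Qed.

(** By Lagrange's identity the squared norm is cosh^2 - 1 of the distance, so the normalising
    factors in [tangent] are sinh of the adjacent sides. *)
Lemma mnorm_crossp u v :
  minkowski u u = -1 -> minkowski v v = -1 -> 1 < - minkowski u v ->
  mnorm (crossp u v) = sinh (hdist u v).
Proof.
move=> Hu Hv lt1; rewrite sinh_arcosh ?ltW// /mnorm minkowski_crossp Hu Hv.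
by rewrite sqrrN mulrNN mulr1 ger0_norm//; nra.
Qed.

(** This is D; since p, q, r are the negated products, its cubic term changes sign. *)
Definition gram_defect A B C : R :=
  1 - 2 * minkowski A B * minkowski A C * minkowski B C
  - minkowski A B ^+ 2 - minkowski A C ^+ 2 - minkowski B C ^+ 2.

Lemma gram_defect_ge0 A B C :
  minkowski A A = -1 -> minkowski B B = -1 -> minkowski C C = -1 ->
  0 <= gram_defect A B C.
Proof.
move=> HA HB HC.
(* Restoring the norms as factors makes the expression homogeneous, so that it becomes a square
   identically in the coordinates. *)
have -> : gram_defect A B C = minkowski A A * minkowski B C ^+ 2
    + minkowski B B * minkowski A C ^+ 2 + minkowski C C * minkowski A B ^+ 2
    - minkowski A A * minkowski B B * minkowski C C
    - 2 * minkowski A B * minkowski A C * minkowski B C.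
  by rewrite /gram_defect HA HB HC; ring.
(* the right-hand side is the square of the determinant of A, B, C *)
rewrite (_ : _ - _ = (A 0 0 * crossp B C 0 0 + A 0 1 * crossp B C 0 1
                    + A 0 2 * crossp B C 0 2) ^+ 2) ?sqr_ge0//.
by rewrite /minkowski /crossp !mxE /=; ring.
Qed.

Lemma minkowski_tangent A B C : minkowski A A = -1 ->
  minkowski (tangent A B) (tangent A C) =
  (minkowski B C + minkowski A B * minkowski A C)
    / (mnorm (crossp A B) * mnorm (crossp A C)).
Proof.
move=> HA; have -> : minkowski B C + minkowski A B * minkowski A C =
    minkowski B C + 2 * (minkowski A B * minkowski A C)
    + minkowski A A * (minkowski A B * minkowski A C) by rewrite HA; ring.
rewrite /tangent invfM; move: (mnorm _)^-1 (mnorm _)^-1 => s t.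
by rewrite /minkowski !mxE; ring.
Qed.

Lemma sin_hangle A B C :
  minkowski A A = -1 -> minkowski B B = -1 -> minkowski C C = -1 ->
  1 < - minkowski A B -> 1 < - minkowski A C ->
  sin (hangle A B C) =
  Num.sqrt (gram_defect A B C) / (sinh (hdist A B) * sinh (hdist A C)).
Proof.
move=> HA HB HC AB AC; have D0 := gram_defect_ge0 HA HB HC.
rewrite /hangle minkowski_tangent// !mnorm_crossp//.
have sq (X : R) : 1 < X ->
    0 < sinh (arcosh X) /\ sinh (arcosh X) ^+ 2 = X ^+ 2 - 1.
  move=> X1; have X2 : 0 < X ^+ 2 - 1 by nra.
  by rewrite sinh_arcosh ?ltW// sqrtr_gt0 sqr_sqrtr// ltW.
have [s0 sE] := sq _ AB; have [t0 tE] := sq _ AC.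
rewrite /hdist; move: (sinh (arcosh (- minkowski A B))) s0 sE => s s0 sE.
move: (sinh _) t0 tE => t t0 tE.
set n := minkowski B C + _.
have E : (s * t) ^+ 2 - n ^+ 2 = gram_defect A B C.
  by rewrite exprMn sE tE /n /gram_defect; ring.
have st0 : 0 < s * t by exact: mulr_gt0.
(* [acos] inverts the cosine only on [-1, 1]; by [E], D >= 0 says exactly that the quotient lies
   there. *)
have n_le : `|n / (s * t)| <= 1.
  rewrite normrM normfV (gtr0_norm st0) ler_pdivrMr// mul1r.
  rewrite -(@ler_pXn2r _ 2) ?nnegrE ?(ltW st0)// real_normK ?num_real//.
  by rewrite -subr_ge0 E.
rewrite sin_acos; last by rewrite -ler_norml.
have -> : 1 - (n / (s * t)) ^+ 2 = gram_defect A B C * (s * t)^-1 ^+ 2.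
  by rewrite -E; field; rewrite !gt_eqF.
by rewrite sqrtrM// sqrtr_sqr gtr0_norm// invr_gt0.
Qed.

Lemma hdistC A B : hdist A B = hdist B A.
Proof. by rewrite /hdist minkowskiC. Qed.

(** Negation changes neither the form nor products of first coordinates, so both sheets reduce to
    the same two facts. *)
Lemma same_sheet (S : set 'rV[R]_3) : S `<=` H2 \/ S `<=` oppH2 ->
  (forall u, S u -> minkowski u u = -1) /\
  (forall u v, S u -> S v -> 0 < u 0 0 * v 0 0).
Proof.
case=> sub; split.
- by move=> u /sub[].
- by move=> u v /sub[_ u0] /sub[_ v0]; apply: mulr_gt0.
- by move=> _ /sub[u [<- _] <-]; rewrite /minkowski !mxE; ring.
- move=> _ _ /sub[u [_ u0] <-] /sub[v [_ v0] <-].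
  by rewrite !mxE mulrNN mulr_gt0.
Qed.

End Minkowski.

Theorem theorem5p10 (R : realType) (A B C : 'rV[R]_3)
    (distinctAB : A <> B) (distinctBC : B <> C) (distinctAC : A <> C)
    (sheet : [set A; B; C] `<=` H2 \/ [set A; B; C] `<=` oppH2) :
  let a := hdist B C in
  let b := hdist A C in
  let c := hdist A B in
  let alpha := hangle A B C in
  let beta := hangle B A C in
  let gamma := hangle C A B in
  sin alpha / sinh a = sin beta / sinh b /\
  sin beta / sinh b = sin gamma / sinh c.
Proof.
have [norm1 sign] := same_sheet sheet.
have SA : [set A; B; C] A by left; left.
have SB : [set A; B; C] B by left; right.
have SC : [set A; B; C] C by right.
have AB := minkowski_lt_N1 (norm1 _ SA) (norm1 _ SB) (sign _ _ SA SB) distinctAB.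
have AC := minkowski_lt_N1 (norm1 _ SA) (norm1 _ SC) (sign _ _ SA SC) distinctAC.
have BC := minkowski_lt_N1 (norm1 _ SB) (norm1 _ SC) (sign _ _ SB SC) distinctBC.
move=> a b c alpha beta gamma; rewrite /alpha /beta /gamma.
rewrite !sin_hangle ?norm1 // 1?(minkowskiC B A) 1?(minkowskiC C A) 1?(minkowskiC C B) //.
rewrite (hdistC B A) (hdistC C A) (hdistC C B) -/a -/b -/c.
have -> : gram_defect B A C = gram_defect A B C.
  by rewrite /gram_defect (minkowskiC B A); ring.
have -> : gram_defect C A B = gram_defect A B C.
  by rewrite /gram_defect (minkowskiC C A) (minkowskiC C B); ring.
move: (sinh a) (sinh b) (sinh c) => x y z.
(* Every ratio is now sqrt D over the product of the three sinh values, up to the order of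
   factors. *)
by rewrite -!mulrA -!invfM; split; congr (_ / _); ring.
Qed.
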